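(* There is an absolute constant $c>0$ such that the following holds. Let $H=([k],E)$ be an oriented graph with $m\ge1$ edges such that $(u,v)\in E$ implies $u<v$, let $\alpha>0$ and $\varepsilon\in(0,1)$. Let $\mathcal X_1,\dots,\mathcal X_k$ be finite nonempty sets, and for every edge $(u,v)\in E$ suppose $A_{uv}\subseteq\mathcal X_u\times\mathcal X_v$ has density $\alpha_{uv}\ge\alpha$. Let $\mathbf x_u\in\mathcal X_u$ ($u\in[k]$) be independent and uniform. (i) If $$\mathbb E\prod_{(u,v)\in E}A_{uv}(\mathbf x_u,\mathbf x_v)\ge(1+\varepsilon)^m\prod_{(u,v)\in E}\alpha_{uv},$$ then for some $(u,v)\in E$ there exists $S\times T\subseteq\mathcal X_u\times\mathcal X_v$ with $\frac{|S||T|}{|\mathcal X_u||\mathcal X_v|}\ge c\,\varepsilon\,\alpha^{m+1}$ such that $$\mathbb E_{(\mathbf x,\mathbf y)\sim S\times T}[A_{uv}(\mathbf x,\mathbf y)]\ge\left(1+\frac{\varepsilon}{2}\right)\alpha_{uv}.$$ (ii) If $$\mathbb E\prod_{(u,v)\in E}A_{uv}(\mathbf x_u,\mathbf x_v)\le(1-\varepsilon)^m\prod_{(u,v)\in E}\alpha_{uv},$$ then for some $(u,v)\in E$ there exists $S\times T\subseteq\mathcal X_u\times\mathcal X_v$ with $\frac{|S||T|}{|\mathcal X_u||\mathcal X_v|}\ge c\,\varepsilon(1-\varepsilon)^{m-1}\alpha^{m}$ such that $$\mathbb E_{(\mathbf x,\mathbf y)\sim S\times T}[A_{uv}(\mathbf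 x,\mathbf y)]\le\left(1-\frac{\varepsilon}{2}\right)\alpha_{uv}.$$
   Context: $[k]=\{1,\dots,k\}$. An oriented graph is a directed graph without pairs of opposite directed edges. A set $A_{uv}\subseteq\mathcal X_u\times\mathcal X_v$ is identified with its indicator function, and its density is $|A_{uv}|/(|\mathcal X_u||\mathcal X_v|)$. All expectations are with respect to uniform distributions. *)

(* Defs.v *)
From HB Require Import structures.
From mathcomp Require Import all_boot all_order all_algebra.
From mathcomp Require Import reals.

Set Implicit Arguments.
Unset Strict Implicit.
Unset Printing Implicit Defensive.

Import Order.TTheory GRing.Theory Num.Theory.
Local Open Scope ring_scope.

(* In particular there are no loops (take u = v). *)
Definition oriented (V : finType) (E : {set V * V}) : Prop :=
  forall u v : V, (u, v) \in E -> (v, u) \notin E.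

Definition indicator (R : realType) (T : finType) (A : {set T}) (x : T) : R :=
  (x \in A)%:R.

Definition density (R : realType) (X Y : finType) (A : {set X * Y}) : R :=
  #|A|%:R / (#|X|%:R * #|Y|%:R).

(* Expectation of f at a uniformly random point of D; since 0^-1 = 0, it is 0
   when D is empty. *)
Definition unif_expect (R : realType) (T : finType) (D : {set T}) (f : T -> R)
    : R :=
  (\sum_(x in D) f x) / #|D|%:R.

(* A family of independent uniform points x_u of X u is the same as a uniform
   point of the product of the X u, represented by dependent finite functions. *)
Definition hom_density (R : realType) (k : nat) (E : {set 'I_k * 'I_k})
    (X : 'I_k -> finType) (A : forall u v : 'I_k, {set X u * X v}) : R :=
  unif_expect [set: {dffun forall u : 'I_k, X u}]
    (fun x => \prod_(e in E) indicator R (A e.1 e.2) (x e.1, x e.2)).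

(* Main.v *)
Require Import Defs.
From mathcomp Require Import all_boot all_order all_algebra.
From mathcomp Require Import reals lra.

Set Implicit Arguments.
Unset Strict Implicit.
Unset Printing Implicit Defensive.

Import Order.TTheory GRing.Theory Num.Theory.
Local Open Scope ring_scope.

(** Expose the edges one at a time. Since the homomorphism density starts at 1,
some edge [uv] changes it by a factor at least [1 + eps] (resp. at most
[1 - eps]) when added to a set [F] of already exposed edges. Freeze all the
coordinates other than [u] and [v]: as [uv] is the only edge between [u] and
[v], the indicator of the edges in [F] becomes the indicator of a rectangle
[S * T]. Averaging over the frozen coordinates the sum over [S * T] of the
deviation of [A u v] from [(1 +/- eps / 2)] times its density yields a
rectangle for which this sum is large; such a rectangle has both the wanted
bias and the wanted size. *)

(** * Indicators and averaging *)

Lemma prod_indicator (R : realType) (I T : finType) (F : {set I})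
    (A : I -> pred T) (x : T) :
  \prod_(e in F) (A e x)%:R = [forall e in F, A e x]%:R :> R.
Proof.
case: (boolP [forall e in F, A e x]) => [/forall_inP FA|].
  by apply: big1 => e /FA ->.
case/forall_inPn => e eF /negbTE NA.
by rewrite (bigD1 e) //= NA mul0r.
Qed.

Lemma exists_ge_unif_expect (R : realType) (T : finType) (f : T -> R)
    (beta : R) :
  (0 < #|T|)%N -> beta <= unif_expect [set: T] f -> exists x, beta <= f x.
Proof.
move=> T0; rewrite /unif_expect cardsT ler_pdivlMr ?ltr0n // => le_sum.
apply/existsP; apply: contraLR le_sum; rewrite negb_exists => /forallP f_lt.
have [x0 _] := card_gt0P T0.
rewrite -ltNge mulr_natr -sumr_const (eq_bigl xpredT) => [|x]; last by rewrite inE.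
apply: ltr_sum => [|x _]; first by apply/hasP; exists x0; rewrite // mem_index_enum.
by rewrite ltNge f_lt.
Qed.

(** * Resampling two coordinates of a point *)

Definition update2 (I : finType) (X : I -> finType) (u v : I)
    (x : {dffun forall i : I, X i}) (ab : X u * X v)
    : {dffun forall i : I, X i} :=
  [ffun i => dfwith (dfwith x ab.1) ab.2 i].

Section Update2.
Variables (I : finType) (X : I -> finType) (u v : I).
Hypothesis uv : u != v.
Implicit Types (x : {dffun forall i : I, X i}) (ab : X u * X v).

Lemma update2_l x ab : update2 x ab u = ab.1.
Proof. by rewrite ffunE dfwith_out ?dfwith_in // eq_sym. Qed.

Lemma update2_r x ab : update2 x ab v = ab.2.
Proof. by rewrite ffunE dfwith_in. Qed.

Lemma update2_out x ab i : u != i -> v != i -> update2 x ab i = x i.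
Proof. by move=> ui vi; rewrite ffunE !dfwith_out. Qed.

(* [(x, a, b) |-> (update2 x (a, b), x u, x v)] is an involution, so it
   preserves the uniform measure. *)
Lemma sum_update2 (R : realType) (G : {dffun forall i : I, X i} -> R) :
  \sum_x \sum_(ab : X u * X v) G (update2 x ab) = \sum_x G x *+ (#|X u| * #|X v|).
Proof.
pose h (p : {dffun forall i : I, X i} * (X u * X v)) :=
  (update2 p.1 p.2, (p.1 u, p.1 v)).
have hK : involutive h.
  case=> x [a b]; rewrite /h /= update2_l update2_r /=; congr pair.
  apply/ffunP => i; have [<-|ui] := eqVneq u i; first by rewrite update2_l.
  by have [<-|vi] := eqVneq v i; rewrite ?update2_r ?update2_out.
rewrite pair_big /= (reindex_inj (inv_inj hK)) /=.
under eq_bigr => p _.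
  have -> : update2 (update2 p.1 p.2) (p.1 u, p.1 v) = p.1.
    by have := congr1 fst (hK p).
  over.
rewrite -(pair_big xpredT xpredT (fun x _ => G x)) /=.
by apply: eq_bigr => x _; rewrite sumr_const card_prod.
Qed.

(** This is the freezing step: a lower bound on the expectation of [G] passes to the average over
    the coordinates [u] and [v] alone, for some choice of the other coordinates. *)
Lemma unif_expect_update2 (R : realType)
    (G : {dffun forall i : I, X i} -> R) :
  (0 < #|X u|)%N -> (0 < #|X v|)%N ->
  unif_expect [set: {dffun forall i : I, X i}]
    (fun x => (\sum_(ab : X u * X v) G (update2 x ab)) / (#|X u|%:R * #|X v|%:R))
  = unif_expect [set: {dffun forall i : I, X i}] G.
Proof.
move=> Xu Xv; rewrite /unif_expect; congr (_ / _).
under eq_bigl do rewrite inE; under [RHS]eq_bigl do rewrite inE.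
rewrite -mulr_suml sum_update2 sumrMnl -natrM -[_ *+ _]mulr_natr mulfK //.
by rewrite pnatr_eq0 -lt0n muln_gt0 Xu.
Qed.

End Update2.

(** * Homomorphism densities and rectangles *)

Section Homomorphisms.
Variables (R : realType) (k : nat) (X : 'I_k -> finType).
Variable A : forall u v : 'I_k, {set X u * X v}.
Hypothesis X_gt0 : forall u, (0 < #|X u|)%N.
Implicit Types (x : {dffun forall u : 'I_k, X u}) (E F : {set 'I_k * 'I_k}).

Definition is_hom F x := [forall e in F, (x e.1, x e.2) \in A e.1 e.2].

Lemma prod_is_hom F x :
  \prod_(e in F) indicator R (A e.1 e.2) (x e.1, x e.2) = (is_hom F x)%:R.
Proof.
exact: (prod_indicator R F (fun e x => (x e.1, x e.2) \in A e.1 e.2)).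
Qed.

Lemma is_homU1 e F x :
  is_hom (e |: F) x = ((x e.1, x e.2) \in A e.1 e.2) && is_hom F x.
Proof.
apply/forall_inP/andP => [H|[H1 /forall_inP H] f].
  split; first by apply: H; rewrite setU11.
  by apply/forall_inP => f fF; apply: H; rewrite setU1r.
by case/setU1P => [->|/H].
Qed.

Lemma card_dffun_gt0 : (0 < #|{: {dffun forall u : 'I_k, X u}}|)%N.
Proof.
by apply/card_gt0P; exists [ffun u => enum_val (Ordinal (X_gt0 u))].
Qed.

Lemma hom_densityE F :
  hom_density R F A
  = (\sum_x (is_hom F x)%:R) / #|{: {dffun forall u : 'I_k, X u}}|%:R.
Proof.
rewrite /hom_density /unif_expect cardsT; congr (_ / _).
by apply: eq_big => x; rewrite ?inE // prod_is_hom.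
Qed.

Lemma hom_density0 : hom_density R set0 A = 1.
Proof.
rewrite hom_densityE (eq_bigr (fun=> 1)) => [|x _].
  by rewrite sumr_const divff // pnatr_eq0 -lt0n card_dffun_gt0.
by rewrite (_ : is_hom _ _) //; apply/forall_inP => e; rewrite inE.
Qed.

Lemma hom_densityS E F : F \subset E -> hom_density R E A <= hom_density R F A.
Proof.
move=> FE; rewrite !hom_densityE ler_pM2r ?invr_gt0 ?ltr0n ?card_dffun_gt0 //.
apply: ler_sum => x _; rewrite ler_nat.
have [/forall_inP HE|//] := boolP (is_hom E x).
have -> // : is_hom F x.
by apply/forall_inP => e /(subsetP FE); apply: HE.
Qed.

(** Fix a point [x] whose inner average over [(a, b)] is at least [beta]. No edge of [F] joins [u]
    and [v], so the condition imposed by each edge depends on [a] alone or on [b] alone. The pairs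
    satisfying all of them thus form a rectangle. *)
Lemma exists_rectangle F (u v : 'I_k) (w : X u * X v -> R) (beta : R) :
  u != v -> (u, v) \notin F -> (v, u) \notin F ->
  beta <= unif_expect [set: {dffun forall u : 'I_k, X u}]
            (fun x => (is_hom F x)%:R * w (x u, x v)) ->
  exists (S : {set X u}) (T : {set X v}),
    beta <= (\sum_(z in setX S T) w z) / (#|X u|%:R * #|X v|%:R).
Proof.
move=> uv uvF vuF.
rewrite -(unif_expect_update2 uv) // => /(exists_ge_unif_expect card_dffun_gt0).
case=> x; pose at_v (e : 'I_k * 'I_k) := (e.1 == v) || (e.2 == v).
(* Edges avoiding both [u] and [v] are counted with [S]: if one of them fails at [x], then [S] is
   empty and both sums vanish. *)
pose S : {set X u} := [set a | is_hom [set e in F | ~~ at_v e] (update2 x (a, x v))].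
pose T : {set X v} := [set b | is_hom [set e in F | at_v e] (update2 x (x u, b))].
move=> le_beta; exists S, T; apply: le_trans le_beta _.
rewrite le_eqVlt; apply/orP; left; apply/eqP; congr (_ / _).
rewrite [RHS]big_mkcond /=; apply: eq_bigr => -[a b] _.
rewrite update2_l // update2_r // -mulrb -[RHS]mulr_natl; congr (_%:R * _).
congr nat_of_bool; rewrite !inE /=.
have upd_v i : v != i -> update2 x (a, b) i = update2 x (a, x v) i.
  move=> vi; have [<-|ui] := eqVneq u i; first by rewrite !update2_l.
  by rewrite !update2_out.
have upd_u i : u != i -> update2 x (a, b) i = update2 x (x u, b) i.
  move=> ui; have [<-|vi] := eqVneq v i; first by rewrite !update2_r.
  by rewrite !update2_out.
have homS e : ~~ at_v e ->
    ((update2 x (a, b) e.1, update2 x (a, b) e.2) \in A e.1 e.2)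
    = ((update2 x (a, x v) e.1, update2 x (a, x v) e.2) \in A e.1 e.2).
  by rewrite negb_or ![_ == v]eq_sym => /andP[e1 e2]; rewrite !upd_v.
have homT e : e \in F -> at_v e ->
    ((update2 x (a, b) e.1, update2 x (a, b) e.2) \in A e.1 e.2)
    = ((update2 x (x u, b) e.1, update2 x (x u, b) e.2) \in A e.1 e.2).
  case: e => i j eF ev.
  suff [ui uj] : u != i /\ u != j by rewrite /= !upd_u.
  case/orP: ev => /= /eqP ev; rewrite {}ev in eF *; split=> //.
  - by apply: contraNneq vuF => ->.
  - by apply: contraNneq uvF => ->.
apply/forall_inP/andP => [H|[/forall_inP HS /forall_inP HT] e eF].
  split; apply/forall_inP => e; rewrite inE => /andP[eF ev].
    by rewrite -homS //; apply: H.
  by rewrite -homT //; apply: H.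
have [ev|ev] := boolP (at_v e).
  by rewrite homT //; apply: HT; rewrite inE eF.
by rewrite homS //; apply: HS; rewrite inE eF.
Qed.

Lemma unif_expect_hom_indicator F (u v : 'I_k) (s t : R) :
  unif_expect [set: {dffun forall u : 'I_k, X u}]
    (fun x => (is_hom F x)%:R * (s * indicator R (A u v) (x u, x v) - t))
  = s * hom_density R ((u, v) |: F) A - t * hom_density R F A.
Proof.
rewrite !hom_densityE /unif_expect cardsT !mulrA -mulrBl; congr (_ / _).
rewrite !mulr_sumr -sumrB; apply: eq_big => x; first by rewrite inE.
move=> _; rewrite is_homU1 /indicator /=.
by case: (is_hom F x); case: (_ \in _); rewrite /=; lra.
Qed.

Lemma density_ge0 (u v : 'I_k) : 0 <= density R (A u v).
Proof. by rewrite /density divr_ge0 ?mulr_ge0. Qed.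

Lemma density_le1 (u v : 'I_k) : density R (A u v) <= 1.
Proof.
rewrite /density -natrM ler_pdivrMr ?ltr0n ?muln_gt0 ?X_gt0 //.
by rewrite mul1r ler_nat -card_prod max_card.
Qed.

End Homomorphisms.

(** * Choosing the edge and the biased rectangle *)

Lemma sum_affine_indicator (R : realType) (T : finType) (D A : {set T})
    (s t : R) :
  \sum_(z in D) (s * indicator R A z - t)
  = (s * unif_expect D (indicator R A) - t) * #|D|%:R.
Proof.
rewrite sumrB -mulr_sumr sumr_const mulrBl -[t *+ _]mulr_natr; congr (_ - _).
rewrite /unif_expect -mulrA; congr (_ * _).
(* For empty [D] the expectation is 0 by convention, which agrees with the empty sum. *)
have [->|D0] := eqVneq D set0; first by rewrite big_set0 cards0 mulr0.
by rewrite divfK // pnatr_eq0 cards_eq0.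
Qed.

Lemma unif_expect_indicator_itv (R : realType) (T : finType) (D A : {set T}) :
  0 <= unif_expect D (indicator R A) <= 1.
Proof.
rewrite /unif_expect; apply/andP; split.
  by apply: divr_ge0 => //; apply: sumr_ge0 => z _; apply: ler0n.
have [->|D0] := eqVneq D set0; first by rewrite big_set0 mul0r.
rewrite ler_pdivrMr ?ltr0n ?card_gt0 // mul1r -sumr_const.
by apply: ler_sum => z _; rewrite lern1 leq_b1.
Qed.

(* [r] stands for [<=] or [>=]. *)
Lemma exists_exposed_edge (R : realType) (I : finType) (r : rel R)
    (P : {set I} -> R) (b : I -> R) (E : {set I}) :
  total r -> transitive r ->
  (forall c x y, 0 <= c -> r x y -> r (c * x) (c * y)) ->
  (forall i, 0 <= b i) -> P set0 = 1 ->
  E != set0 -> r (P E) (\prod_(i in E) b i) ->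
  exists (F : {set I}) (i : I), [/\ i |: F \subset E, i \notin F,
    r (\prod_(j in F) b j) (P F) & r (P (i |: F)) (b i * P F)].
Proof.
move=> r_total r_trans r_mul b0 P0.
have [n] := ubnP #|E|; elim: n E => // n IH E ltEn /set0Pn[i iE] rE.
have iD : i \notin E :\ i by rewrite setD11.
have prodE : \prod_(j in E) b j = b i * \prod_(j in E :\ i) b j.
  by rewrite -{1}(setD1K iE) big_setU1.
(* If [P (E :\ i)] is on the other side of its product, then adding [i] is the wanted step: [P E]
   compares with [b i] times the product over [E :\ i], hence with [b i * P (E :\ i)]. *)
have done_at : r (\prod_(j in E :\ i) b j) (P (E :\ i)) ->
    exists (F : {set I}) (i : I), [/\ i |: F \subset E, i \notin F,
      r (\prod_(j in F) b j) (P F) & r (P (i |: F)) (b i * P F)].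
  move=> rD; exists (E :\ i), i; split; rewrite ?setD1K //.
  by apply: r_trans rE _; rewrite prodE; apply: r_mul.
have [D0|D0] := eqVneq (E :\ i) set0.
  by apply: done_at; rewrite D0 big_set0 P0; have /orP[] := r_total 1 1.
(* Otherwise, by totality, [E :\ i] inherits the hypothesis on [E] and the induction applies. *)
have /orP[|rD] := r_total (\prod_(j in E :\ i) b j) (P (E :\ i)).
  exact: done_at.
have [|F [j [jFE jF rF rj]]] := IH (E :\ i) _ D0 rD.
  by move: ltEn; rewrite (cardsD1 i) iE.
exists F, j; split=> //; exact: subset_trans jFE (subsetDl _ _).
Qed.

(** Taking [s] to be 1 or -1 treats excess and deficit together. The total deviation on the
    rectangle is its relative size times the mean deviation [s * y - t]. As the mean is at most 1,
    the size is at least [beta]; as [beta] is positive, the mean cannot be negative. *)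
Lemma exists_biased_rectangle (R : realType) (k : nat) (X : 'I_k -> finType)
    (A : forall u v : 'I_k, {set X u * X v}) (F : {set 'I_k * 'I_k})
    (u v : 'I_k) (s t beta : R) :
  (forall u, (0 < #|X u|)%N) ->
  u != v -> (u, v) \notin F -> (v, u) \notin F ->
  (forall y : R, 0 <= y <= 1 -> s * y - t <= 1) -> 0 < beta ->
  beta <= s * hom_density R ((u, v) |: F) A - t * hom_density R F A ->
  exists (S : {set X u}) (T : {set X v}),
    beta <= (#|S|%:R * #|T|%:R) / (#|X u|%:R * #|X v|%:R) /\
    t <= s * unif_expect (setX S T) (indicator R (A u v)).
Proof.
move=> X_gt0 uv uvF vuF st1 beta0.
rewrite -unif_expect_hom_indicator.
move=> /(exists_rectangle X_gt0 (w := fun z => s * indicator R (A u v) z - t)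
          uv uvF vuF).
case=> S [T]; rewrite sum_affine_indicator cardsX natrM -mulrA => le_beta.
exists S, T; move: le_beta; set y := unif_expect _ _; set q := _ / _ => le_beta.
have q0 : 0 <= q by rewrite divr_ge0 ?mulr_ge0.
have y1 : s * y - t <= 1 by apply/st1/unif_expect_indicator_itv.
split; first by apply: le_trans le_beta _; rewrite ler_piMl.
rewrite -subr_ge0 leNgt; apply/negP => y0.
have := lt_le_trans beta0 le_beta; rewrite ltNge => /negP; apply.
by rewrite mulr_le0_ge0 // ltW.
Qed.

Theorem theorem2p2 (R : realType) :
  exists c : R, 0 < c /\
  forall (k : nat) (E : {set 'I_k * 'I_k}) (m : nat) (alpha eps : R)
         (X : 'I_k -> finType) (A : forall u v : 'I_k, {set X u * X v}),
    oriented E ->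
    #|E| = m ->
    (1 <= m)%N ->
    (forall u v : 'I_k, (u, v) \in E -> (u < v)%N) ->
    0 < alpha ->
    0 < eps < 1 ->
    (forall u : 'I_k, (0 < #|X u|)%N) ->
    (forall u v : 'I_k, (u, v) \in E -> alpha <= density R (A u v)) ->
    (hom_density R E A
       >= (1 + eps) ^+ m * \prod_(e in E) density R (A e.1 e.2) ->
     exists u v : 'I_k, (u, v) \in E /\
     exists (S : {set X u}) (T : {set X v}),
       (#|S|%:R * #|T|%:R) / (#|X u|%:R * #|X v|%:R)
         >= c * eps * alpha ^+ m.+1 /\
       unif_expect (setX S T) (indicator R (A u v))
         >= (1 + eps / 2) * density R (A u v)) /\
    (hom_density R E A
       <= (1 - eps) ^+ m * \prod_(e in E) density R (A e.1 e.2) ->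
     exists u v : 'I_k, (u, v) \in E /\
     exists (S : {set X u}) (T : {set X v}),
       (#|S|%:R * #|T|%:R) / (#|X u|%:R * #|X v|%:R)
         >= c * eps * (1 - eps) ^+ m.-1 * alpha ^+ m /\
       unif_expect (setX S T) (indicator R (A u v))
         <= (1 - eps / 2) * density R (A u v)).
Proof.
(* The factor 1/2 is what remains when the target bias [eps / 2] is subtracted from the bias [eps]
   gained at the exposed edge. *)
exists 2^-1; split; first by rewrite invr_gt0 ltr0n.
move=> k E m alpha eps X A orE cardE m_gt0 ltE alpha_gt0 /andP[eps_gt0 eps_lt1].
move=> X_gt0 le_alpha.
have d_ge0 (e : 'I_k * 'I_k) := density_ge0 R A e.1 e.2.
have d_le1 (e : 'I_k * 'I_k) := density_le1 R A X_gt0 e.1 e.2.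
have le_alphaE e : e \in E -> alpha <= density R (A e.1 e.2).
  by case: e => u v; apply: le_alpha.
have E0 : E != set0 by rewrite -card_gt0 cardE.
have alpha_le1 : alpha <= 1.
  by have [e /le_alphaE le_e] := set0Pn _ E0; apply: le_trans le_e _.
have prod_b b : \prod_(e in E) (b * density R (A e.1 e.2))
    = b ^+ m * \prod_(e in E) density R (A e.1 e.2).
  by rewrite big_split prodr_const cardE.
(* The order on vertices excludes loops, and orientedness keeps the reversed edge out of [F]. *)
have non_edges F u v : (u, v) |: F \subset E -> (u, v) \in E /\ ((u, v) \notin F ->
    [/\ u != v, (u, v) \notin F & (v, u) \notin F]).
  move=> /subsetP FE; have uvE : (u, v) \in E by rewrite FE ?setU11.
  split=> // uvF; split=> //; first by have := ltE _ _ uvE; rewrite ltn_neqAle => /andP[].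
  by apply: contra (orE _ _ uvE) => vuF; rewrite FE ?setU1r.
split=> homE; rewrite -prod_b in homE.
  have b_ge0 (e : 'I_k * 'I_k) : 0 <= (1 + eps) * density R (A e.1 e.2).
    by rewrite mulr_ge0 // addr_ge0 // ltW.
  have [|||F [[u v] [uvFE uvF _ /= le_uv]]] :=
    exists_exposed_edge (r := >=%R) (P := fun F => hom_density R F A)
      _ _ _ b_ge0 (hom_density0 R A X_gt0) E0 homE.
  - by move=> x y; apply: le_total.
  - exact: ge_trans.
  - by move=> c x y c0 /=; apply: ler_wpM2l.
  have [uvE /(_ uvF)[neq_uv _ vuF]] := non_edges _ _ _ uvFE.
  exists u, v; split=> //.
  (* Exposing edges only lowers the density, so the density of [F] is at least that of [E], which is
     large by assumption. The exposed edge then contributes one more factor [alpha]. *)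
  have le_hom : alpha ^+ m <= hom_density R F A.
    have FE : F \subset E by apply: subset_trans uvFE; apply: subsetUr.
    apply: le_trans (hom_densityS R A X_gt0 FE); apply: le_trans homE.
    rewrite -cardE -prodr_const; apply: ler_prod => e eE.
    rewrite (ltW alpha_gt0) /=; apply: le_trans (le_alphaE e eE) _.
    by rewrite ler_peMl // lerDl ltW.
  have le_d : alpha * alpha ^+ m <= density R (A u v) * hom_density R F A.
    by apply: ler_pM; rewrite ?exprn_ge0 ?le_alpha // ltW.
  have := d_ge0 (u, v); have := d_le1 (u, v) => /= d1 d0.
  have [|||S [T [le_q le_U]]] := exists_biased_rectangle (A := A) (s := 1)
    (t := (1 + eps / 2) * density R (A u v)) (beta := 2^-1 * eps * alpha ^+ m.+1)
    X_gt0 neq_uv uvF vuF.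
  - move=> y /andP[_ y1]; rewrite mul1r lerBlDr.
    by apply: le_trans y1 _; rewrite lerDl mulr_ge0 // addr_ge0 // divr_ge0 // ltW.
  - by rewrite !mulr_gt0 ?exprn_gt0 ?invr_gt0 ?ltr0n.
  - by rewrite exprS; nra.
  by exists S, T; split=> //; rewrite mul1r in le_U.
have b_ge0 (e : 'I_k * 'I_k) : 0 <= (1 - eps) * density R (A e.1 e.2).
  by rewrite mulr_ge0 // subr_ge0 ltW.
have [|||F [[u v] [uvFE uvF /= le_F le_uv]]] :=
  exists_exposed_edge (r := <=%R) (P := fun F => hom_density R F A)
    _ _ _ b_ge0 (hom_density0 R A X_gt0) E0 homE.
- by move=> x y; apply: le_total.
- exact: le_trans.
- by move=> c x y c0 /=; apply: ler_wpM2l.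
have [uvE /(_ uvF)[neq_uv _ vuF]] := non_edges _ _ _ uvFE.
exists u, v; split=> //.
(* Here the density of [E] is only bounded above, so the lower bound comes from the choice of [F]:
   its density is at least its product of [(1 - eps)] times edge densities. Since [F] misses
   [(u, v)], it has at most [m.-1] edges, and [(1 - eps) * alpha] is at most 1. *)
have le_hom : ((1 - eps) * alpha) ^+ m.-1 <= hom_density R F A.
  have FE : F \subset E by apply: subset_trans uvFE; apply: subsetUr.
  have le_card : (#|F| <= m.-1)%N.
    by have := subset_leq_card uvFE; rewrite cardsU1 uvF cardE; case: (m) m_gt0.
  apply: le_trans le_F.
  apply: (@le_trans _ _ (((1 - eps) * alpha) ^+ #|F|)).
    by apply: ler_wiXn2l => //; nra.
  rewrite -prodr_const; apply: ler_prod => e eF; apply/andP; split; first by nra.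
  by rewrite ler_wpM2l ?subr_ge0 ?le_alphaE ?(subsetP FE) // ltW.
have le_d : alpha * ((1 - eps) * alpha) ^+ m.-1
    <= density R (A u v) * hom_density R F A.
  by apply: ler_pM; rewrite ?exprn_ge0 ?le_alpha ?mulr_ge0 ?subr_ge0 // ltW.
have -> : 2^-1 * eps * (1 - eps) ^+ m.-1 * alpha ^+ m
    = 2^-1 * eps * (alpha * ((1 - eps) * alpha) ^+ m.-1).
  by rewrite exprMn -{2}(prednK m_gt0) exprS -!mulrA; congr (_ * (_ * _)); rewrite mulrCA.
have := d_ge0 (u, v); have := d_le1 (u, v) => /= d1 d0.
(* With [s = -1] the deviation is the deficit below [(1 - eps / 2)] times the density, at most 1
   because the density is. *)
have [|||S [T [le_q le_U]]] := exists_biased_rectangle (A := A) (s := -1)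
  (t := - ((1 - eps / 2) * density R (A u v)))
  (beta := 2^-1 * eps * (alpha * ((1 - eps) * alpha) ^+ m.-1))
  X_gt0 neq_uv uvF vuF.
- by move=> y /andP[y0 _]; nra.
- by rewrite !mulr_gt0 ?exprn_gt0 ?invr_gt0 ?ltr0n ?mulr_gt0 ?subr_gt0.
- by nra.
by exists S, T; split=> //; rewrite mulN1r lerN2 in le_U.
Qed.
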